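(* Suppose that $q\in(0,1)$, and that $a\neq 0$ and $b$ are real numbers with $b<0$ and $|b|>|a|$, and put $\kappa=-\log|b/a|/\log(1/q)$. Let $f\in C([0,\infty);\mathbb{R})$, let $\zeta\in\mathbb{R}$, and let $x$ be the unique continuous solution of $$x'(t)=ax(qt)+bx(t)+f(t),\quad t\ge 0;\qquad x(0)=\zeta .$$ Let $y$ be the unique continuous solution of $y'(t)=-y(t)+f(t)$, $t\ge 0$, $y(0)=0$. Let $\gamma\in\mathrm{RV}_\infty(\eta)$. (i) Let $y(t)=O(\gamma(t))$ as $t\to\infty$. (A) If $\eta<\kappa$, then $x(t)=O(t^\kappa)$ as $t\to\infty$. (B) If $\eta=\kappa$ and $t\mapsto\gamma(t)/t^{\kappa+1}$ is in $L^1(0,\infty)$, then $x(t)=O(t^\kappa)$ as $t\to\infty$. Moreover, if $\limsup_{t\to\infty}|y(t)|/\gamma(t)\in(0,\infty)$, then $\limsup_{t\to\infty}|x(t)|/\gamma(t)>0$. (C) If $\eta=\kappa$ and $t\mapsto\gamma(t)/t^{\kappa+1}$ is not in $L^1(0,\infty)$, then $$x(t)=O\left(t^\kappa\int_1^t\frac{\gamma(s)}{s^{\kappa+1}}\,ds\right),\quad t\to\infty.$$ Moreover, $\limsup_{t\to\infty}|y(t)|/\gamma(t)>0$ implies $\limsup_{t\to\infty}|x(t)|/\gamma(t)>0$. (ii) If $x(t)=O(\gamma(t))$ as $t\to\infty$, then $y(t)=O(\gamma(t))$ as $t\to\infty$. Likewise, if $x(t)=o(\gamma(t))$ as $t\to\infty$,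 then $y(t)=o(\gamma(t))$ as $t\to\infty$.
   Context: $\gamma\in\mathrm{RV}_\infty(\eta)$ means that $\gamma:[0,\infty)\to(0,\infty)$ is measurable and regularly varying at infinity with index $\eta\in\mathbb{R}$: $\lim_{t\to\infty}\gamma(\lambda t)/\gamma(t)=\lambda^\eta$ for every $\lambda>0$. Integrals of positive functions are understood with values in $[0,\infty]$. *)

(* Defs.v *)
From HB Require Import structures.
From mathcomp Require Export all_boot all_order all_algebra.
From mathcomp Require Export all_classical all_reals all_analysis.
Export numFieldNormedType.Exports.
Set Implicit Arguments.
Unset Strict Implicit.
Unset Printing Implicit Defensive.
Import Order.TTheory GRing.Theory Num.Theory.

Local Open Scope classical_set_scope.
Local Open Scope ring_scope.

(* Needed by the Landau notations [=O_+oo] and [=o_+oo]. *)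
Canonical pinfty_filter_on (R : numFieldType) :=
  FilterType (pinfty_nbhs R) _.

(* The real line carrying its Lebesgue (Caratheodory) sigma-algebra, that is,
   the domain of [completed_lebesgue_measure]; the default structure on [R]
   only has the Borel sets. *)
Notation lebesgueTypeR R := (caratheodory_type ((@wlength R idfun)^*)%mu).

(* Functions on [0, +oo) are functions [R -> R] whose values at negative
   arguments are irrelevant.  The derivative at 0 is the right derivative. *)
Definition solves_on_nonneg (R : realType) (x rhs : R -> R) (x0 : R) : Prop :=
  [/\ {within `[0, +oo[, continuous x},
      x 0 = x0,
      (h^-1 * (x h - x 0)) @[h --> 0^'+] --> rhs 0 &
      forall t : R, 0 < t -> is_derive t 1 x (rhs t)].

Definition pantograph_solution (R : realType) (q a b : R) (f : R -> R)
    (zeta : R) (x : R -> R) : Prop :=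
  solves_on_nonneg x (fun t => a * x (q * t) + b * x t + f t) zeta.

Definition perturbation_solution (R : realType) (f y : R -> R) : Prop :=
  solves_on_nonneg y (fun t => - y t + f t) 0.

Definition regularly_varying (R : realType) (eta : R) (g : R -> R) : Prop :=
  [/\ measurable_fun (`[0, +oo[ : set (lebesgueTypeR R)) g,
      forall t : R, 0 <= t -> 0 < g t &
      forall l : R, 0 < l -> g (l * t) / g t @[t --> +oo] --> l `^ eta].

(* Landau's O for a bound with values in [0, +oo].  The constant is positive,
   so that the bound says nothing where [g] is infinite. *)
Definition ebigO_pinfty (R : realType) (x : R -> R) (g : R -> \bar R) : Prop :=
  exists2 C : R, 0 < C & \forall t \near +oo, (`|x t|%:E <= C%:E * g t)%E.

Definition limsup_ratio (R : realType) (x g : R -> R) : \bar R :=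
  limf_esup (fun t => (`|x t| / g t)%:E) +oo.

Definition kappa (R : realType) (q a b : R) : R :=
  - ln `|b / a| / ln q^-1.

Definition weighted (R : realType) (k : R) (g : R -> R) (t : R) : \bar R :=
  (g t / t `^ (k + 1))%:E.

Definition weighted_L1 (R : realType) (k : R) (g : R -> R) : Prop :=
  (@completed_lebesgue_measure R).-integrable `]0, +oo[ (weighted k g).

Definition weighted_integral (R : realType) (k : R) (g : R -> R) (t : R) :
    \bar R :=
  (\int[@completed_lebesgue_measure R]_(s in `[1%R, t]) weighted k g s)%E.

(* Main.v *)
Require Import Defs.
From mathcomp Require Import measurable_realfun ring lra.

(** The idea of the proof.

The delay equation and the relaxation equation for y share the forcing f, so
f can be eliminated: the difference of x and y solves a linear equation whose
forcing only involves x (for part (ii)) or only involves y (for part (i)).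
Both comparisons are then instances of one maximum principle
([barrier_norm]): if v' = - c v + p with c >= c0 > 0 and |p| <= P, then |v|
never exceeds the larger of its initial value and P / c0.

For (ii), w = y - x solves w' = - w + p with p(t) = - a x(qt) - (b+1) x(t).
Weighting w by a high power of t makes t^N gamma(t) almost increasing while it
changes the damping coefficient only to 1 - N/t, so the maximum principle turns
|p| <= e gamma into |w| <= C e gamma with C independent of e ([relaxation]);
this gives the O and the o statement at once.  The claims on the limsup in (B)
and (C) are the contrapositive of the o statement.

For (i), z = x - y solves the pantograph equation with forcing
h(t) = a y(qt) + (b+1) y(t) = O(gamma).  The exponent kappa is the one for which
|a| q^kappa = |b|, so that u(t) = t^(-kappa) z(t) satisfies
u' = - (|b| + kappa/t) u + (a coefficient of modulus |b|) u(qt) + t^(-kappa) h.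
On the block from T_n to T_(n+1), where T_n = T_0 q^(-n), the maximum principle
bounds |u| by (1 + O(q^n)) times its bound on earlier times, plus a multiple of
theta(T_n), where theta(t) = gamma(t) t^(-kappa).  The product of the factors
1 + O(q^n) converges, so |u| is bounded on block n by a multiple of
1 + sum of theta(T_j) for j < n ([pantograph_growth], [solution_growth]).  If
eta < kappa this sum is dominated by a geometric series; in general theta(T_j)
is at most a multiple of the integral of gamma(s) s^(-kappa-1) over block j
([weighted_sum]), which yields (B) and (C).

All this uses regular variation only through Potter type bounds
([potter_of_rv]), and these rest on the fact that gamma(lt)/gamma(t) is bounded
above and away from 0 uniformly for l in [1,2] and t large ([uniform_bound]).
That is a measure theoretic fact, proved by the Steinhaus argument that two
sets of nearly full measure must meet; it needs the behaviour of the completed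
Lebesgue measure under dilations ([measure_dilate], [measurable_dilate]). *)

Import Order.TTheory GRing.Theory Num.Theory.
Set Implicit Arguments.
Unset Strict Implicit.
Unset Printing Implicit Defensive.
Local Open Scope classical_set_scope.
Local Open Scope ring_scope.

(** * Dilations of the completed Lebesgue measure *)

Section Dilation.
Context {R : realType}.
Local Notation mu := (@completed_lebesgue_measure R).

(** The set A scaled by 1/c, written as a preimage so that it commutes
    definitionally with intersections and complements. *)
Definition dilate (c : R) (A : set R) : set R := [set s | A (c * s)].

Lemma dilate_ocitv (c u v : R) : 0 < c ->
  dilate c `]u, v] = `](u / c), (v / c)]%classic.
Proof.
move=> c0; apply/seteqP; split => s /=;
  by rewrite !in_itv/= ltr_pdivrMr// ler_pdivlMr// !(mulrC s).
Qed.

Lemma wlength_dilate (c : R) (A : set (ocitv_type R)) : 0 < c ->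
  measurable A ->
  measurable (dilate c A : set (ocitv_type R)) /\
  wlength idfun (dilate c A) = ((c^-1)%:E * wlength idfun A)%E.
Proof.
move=> c0 [[u v] _ <-]/=; rewrite dilate_ocitv//; split; first exact: is_ocitv.
have [uv|vu] := leP u v.
  by rewrite !wlength_itv_bnd// ?ler_pM2r ?invr_gt0// -EFinM; congr _%:E; rewrite /= ; ring.
by rewrite !set_itv_ge ?wlength0 ?mule0//= ?bnd_simp -leNgt// ?ler_pM2r ?invr_gt0// ltW.
Qed.

(** A cover of A by half-open intervals scales to a cover of [dilate c A], with
    all lengths divided by c. *)
Lemma le_measure_dilate (c : R) (A : set R) : 0 < c ->
  (c%:E * mu (dilate c A) <= mu A)%E.
Proof.
move=> c0; apply: le_ereal_inf_tmp => _ [B [mB AB] <-].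
have -> : (\sum_(k <oo) wlength idfun (B k) =
  c%:E * \sum_(k <oo) wlength idfun (dilate c (B k)))%E.
  rewrite -nneseriesZl//=.
  apply: eq_eseriesr => k _; rewrite (wlength_dilate c0 (mB k)).2 muleA -EFinM.
  by rewrite divff ?gt_eqF// mul1e.
rewrite lee_pmul2l ?lte_fin//; apply: ereal_inf_lbound.
exists (fun k => dilate c (B k)) => //; split.
  by move=> k; exact: (wlength_dilate c0 (mB k)).1.
by move=> s /AB [k _ Bk]; exists k.
Qed.

(** Equality follows from the inequality for c and for 1/c. *)
Lemma measure_dilate (c : R) (A : set R) : 0 < c ->
  (c%:E * mu (dilate c A) = mu A)%E.
Proof.
move=> c0; apply/eqP; rewrite eq_le le_measure_dilate//=.
have ci : 0 < c^-1 by rewrite invr_gt0.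
have := le_measure_dilate (dilate c A) ci.
rewrite /dilate/=; under [X in mu X]eq_fun do rewrite mulrA divff ?gt_eqF// mul1r.
by rewrite -(@lee_pmul2l _ c%:E)// muleA -EFinM divff ?gt_eqF// mul1e.
Qed.

(** Dilations are bijections that multiply the outer measure by a constant, so
    they preserve Caratheodory's splitting condition. *)
Lemma measurable_dilate (c : R) (A : set (lebesgueTypeR R)) : 0 < c ->
  measurable A -> measurable (dilate c A : set (lebesgueTypeR R)).
Proof.
move=> c0 mA; have ci : 0 < c^-1 by rewrite invr_gt0.
suff : caratheodory_measurable mu (dilate c A) by [].
move=> X.
have E Y : dilate c (dilate c^-1 Y) = Y.
  apply/seteqP; split => s; rewrite /dilate/= mulrA mulVf ?gt_eqF// mul1r//.
have S Y : mu (dilate c Y) = ((c^-1)%:E * mu Y)%E.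
  by rewrite -(measure_dilate Y c0) muleA -EFinM mulVf ?gt_eqF// mul1e.
have H : mu (dilate c^-1 X) = (mu (dilate c^-1 X `&` A) +
    mu (dilate c^-1 X `&` ~` A))%E := mA (dilate c^-1 X).
have D : X `&` dilate c A = dilate c (dilate c^-1 X `&` A).
  by rewrite -{1}(E X).
have D' : X `&` ~` dilate c A = dilate c (dilate c^-1 X `&` ~` A).
  by rewrite -{1}(E X).
by rewrite D D' -{1}(E X) !S -ge0_muleDr// H.
Qed.

End Dilation.

(** * Uniform boundedness of a regularly varying function *)

Section RegularVariation.
Context {R : realType}.
Local Notation mu := (@completed_lebesgue_measure R).

Lemma measurable_itv_completed (i : interval R) :
  measurable ([set` i] : set (lebesgueTypeR R)).
Proof.
apply: (@sub_caratheodory _ (ocitv_type R) R (wlength idfun)).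
exact: measurable_itv.
Qed.

Lemma completed_measure_itvcc (u v : R) : u <= v ->
  mu `[u, v]%classic = (v - u)%:E.
Proof.
move=> uv; rewrite -[LHS]/(lebesgue_measure `[u, v]%classic).
rewrite lebesgue_measure_itv/= lte_fin; case: ltP => /= [_|vu]; rewrite ?EFinB//.
by have -> : u = v; [apply/eqP; rewrite eq_le uv|rewrite subee].
Qed.

Lemma measurable_bounded_ratio (g : R -> R) (t lo hi : R) :
  0 < t -> measurable_fun (`[0, +oo[ : set (lebesgueTypeR R)) g ->
  measurable ([set l | l \in `[1, 4] /\ lo <= g (l * t) <= hi]
               : set (lebesgueTypeR R)).
Proof.
move=> t0 mg.
have -> : [set l | l \in `[1, 4] /\ lo <= g (l * t) <= hi] =
    `[1, 4] `&` dilate t (`[0, +oo[ `&` g @^-1` `[lo, hi]).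
  apply/seteqP; split => l /=; rewrite /dilate/= !in_itv/= andbT mulrC.
    case=> /andP[l1 l4] H; rewrite l1 l4.
    by have tl : 0 <= t * l; [rewrite mulr_ge0//; lra|do !split].
  by case=> -> [].
apply: measurableI; first exact: measurable_itv_completed.
apply: measurable_dilate => //.
apply: mg; first exact: measurable_itv_completed.
exact: measurable_itv.
Qed.

(** The dilation factors in [1,4] at which g changes by a factor of at most k,
    along the tail from n of a sequence t.  Using a sequence instead of all
    large t keeps the intersection countable, hence the set measurable. *)
Definition bounded_ratio_set (g : R -> R) (k : R) (t : nat -> R) (n : nat) : set R :=
  \bigcap_(m in [set m | (n <= m)%N])
    [set l | l \in `[1, 4] /\ k^-1 * g (t m) <= g (l * t m) <= k * g (t m)].

Lemma bounded_ratio_set_sub g k t n : bounded_ratio_set g k t n `<=` `[1, 4].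
Proof. by move=> l /(_ n (leqnn n))[]. Qed.

Lemma bounded_ratio_setS g k t n m : (n <= m)%N ->
  bounded_ratio_set g k t n `<=` bounded_ratio_set g k t m.
Proof. by move=> nm l H p /= mp; apply: H => /=; exact: leq_trans mp. Qed.

Lemma powR_between (eta l : R) : 1 <= l <= 4 ->
  (1 + 4 `^ `|eta|)^-1 < l `^ eta < 1 + 4 `^ `|eta|.
Proof.
move=> /andP[l1 l4]; have l0 : 0 < l by lra.
have E : l `^ `|eta| <= 4 `^ `|eta| by rewrite ge0_ler_powR// ?nnegrE; lra.
have P : 0 < l `^ `|eta| by exact: powR_gt0.
have L : l `^ eta <= l `^ `|eta| by rewrite ler_powR// ler_norm.
have L' : l `^ (- `|eta|) <= l `^ eta by rewrite ler_powR// lerNl -normrN ler_norm.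
apply/andP; split; last by lra.
apply: lt_le_trans L'; rewrite powRN ltf_pV2 ?posrE//; lra.
Qed.

(** Regular variation puts each l in [1,4] into these sets from some n on, so
    they increase to [1,4], which has measure 3. *)
Lemma bounded_ratio_set_large (eta : R) (g : R -> R) (t : nat -> R) :
  regularly_varying eta g -> (forall n, n.+1%:R <= t n) ->
  exists n, ((5 / 2)%:E < mu (bounded_ratio_set g (1 + 4 `^ `|eta|) t n))%E.
Proof.
move=> [mg g0 hg] ht; set k := 1 + _.
have k0 : 0 < k by rewrite ltr_wpDr// powR_ge0.
have t0 n : 0 < t n by apply: lt_le_trans (ht n); rewrite ltr0n.
have mV n : measurable (bounded_ratio_set g k t n : set (lebesgueTypeR R)).
  apply: bigcap_measurable; first by exists n => /=.
  by move=> m _; exact: measurable_bounded_ratio.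
have UV : \bigcup_n bounded_ratio_set g k t n = `[1, 4]%classic.
  apply/seteqP; split; first by move=> l [n _ /bounded_ratio_set_sub].
  move=> l /= l14; have /andP[kl lk] : k^-1 < l `^ eta < k.
    by apply: powR_between; move: l14; rewrite in_itv/=.
  have l0 : 0 < l by move: l14; rewrite in_itv/= => /andP[]; lra.
  have /cvgrPdist_lt H := hg l l0.
  pose e := Num.min (k - l `^ eta) (l `^ eta - k^-1).
  have e0 : 0 < e by rewrite lt_min !subr_gt0 lk kl.
  have [M [_ HM]] := H e e0.
  have [N MN] : exists N : nat, M < N.+1%:R.
    exists (Num.truncn `|M|); apply: le_lt_trans (ler_norm _) _.
    exact: truncnS_gt.
  exists N => // m /= Nm; split => //.
  have /HM : M < t m.
    by apply: lt_le_trans MN _; apply: le_trans (ht m); rewrite ler_nat ltnS.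
  have gp : 0 < g (t m) by apply: g0; exact: ltW.
  rewrite /= /e lt_min => /andP[H1 H2].
  rewrite -[_ <= k * _]ler_pdivrMr// -[_ * _ <= _]ler_pdivlMr//.
  by move: H1 H2; rewrite !ltr_norml; lra.
have cV : mu (bounded_ratio_set g k t n) @[n --> \oo] --> mu (`[1, 4]%classic : set R).
  rewrite -UV; apply: nondecreasing_cvg_mu => //.
    by rewrite UV; exact: measurable_itv_completed.
  by move=> n m nm; apply/subsetPset/bounded_ratio_setS.
have : nbhs (mu (`[1, 4]%classic : set R)) [set v | ((5 / 2)%:E < v)%E].
  apply: open_nbhs_nbhs; split; first exact: open_ereal_gt_ereal.
  by rewrite /= completed_measure_itvcc ?lte_fin; lra.
by move=> /cV; case=> n _ H; exists n; exact: (H n (leqnn n)).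
Qed.

(** Otherwise B and A scaled by 1/l would be disjoint subsets of [1/l,4] with
    total measure above 5/2 + 5/(2l), which exceeds 4 - 1/l when l <= 2. *)
Lemma large_sets_meet (A B : set (lebesgueTypeR R)) (l : R) :
  measurable A -> measurable B -> A `<=` `[1, 4] -> B `<=` `[1, 4] ->
  1 <= l <= 2 -> ((5 / 2)%:E < mu A)%E -> ((5 / 2)%:E < mu B)%E ->
  exists s, A (l * s) /\ B s.
Proof.
move=> mA mB A14 B14 /andP[l1 l2] hA hB; apply: contrapT => H.
have l0 : 0 < l by lra.
have dis : dilate l A `&` B = set0.
  by apply/seteqP; split => // s [As Bs]; apply: H; exists s.
have mD := measurable_dilate l0 mA.
have li : l^-1 <= 1 by rewrite invf_le1.
have li2 : 2^-1 <= l^-1 by rewrite lef_pV2// posrE.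
have sub : dilate l A `|` B `<=` `[l^-1, 4]%classic.
  move=> s [/A14|/B14] /=; rewrite !in_itv/= => /andP[s1 s2]; apply/andP; split.
  - by rewrite -[leLHS]mulr1 ler_pdivrMl.
  - by rewrite -(ler_pM2l l0); nra.
  - exact: le_trans s1.
  - by [].
have : (mu (dilate l A) + mu B <= (4 - l^-1)%:E)%E.
  rewrite -measureU// -completed_measure_itvcc; last by lra.
  apply: le_measure => //; rewrite inE; first exact: measurableU.
  exact: measurable_itv_completed.
apply/negP; rewrite -ltNge.
have : ((5 / 2 * l^-1)%:E < mu (dilate l A))%E.
  by rewrite -(@lte_pmul2l _ l%:E)// measure_dilate// -EFinM mulrCA divff ?gt_eqF// mulr1.
move=> hD; apply: le_lt_trans (lteD hD hB).
by rewrite -EFinD lee_fin; lra.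
Qed.

(** Suppose the bound fails along points t_n with factors l_n.  Applied to the
    two sequences t_n and l_n t_n, [large_sets_meet] produces s such that l_n s
    is a good factor for t_n and s is one for l_n t_n; then g(t_n) and
    g(l_n t_n) are both within a factor k of g(s l_n t_n), hence within k^2 of
    each other. *)
Lemma uniform_bound (eta : R) (g : R -> R) : regularly_varying eta g ->
  exists K X : R, [/\ 1 <= K, 0 < X & forall t l, X <= t -> 1 <= l <= 2 ->
    g (l * t) <= K * g t /\ g t <= K * g (l * t)].
Proof.
move=> rv; pose k : R := 1 + 4 `^ `|eta|; have [mg g0 _] := rv.
have k1 : 1 <= k by rewrite lerDl powR_ge0.
have k0 : 0 < k by lra.
apply: contrapT => H.
have /choice[p hp] (n : nat) : exists p : R * R, [/\ n.+1%:R <= p.1, 1 <= p.2 <= 2 &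
    ~ (g (p.2 * p.1) <= k ^+ 2 * g p.1 /\ g p.1 <= k ^+ 2 * g (p.2 * p.1))].
  apply: contrapT => Hn; apply: H; exists (k ^+ 2), n.+1%:R; split => //.
    by rewrite expr_ge1// ltW.
  by move=> t l ht hl; apply: contrapT => Hf; apply: Hn; exists (t, l).
pose t n := (p n).1; pose t' n := (p n).2 * (p n).1.
have ht n : n.+1%:R <= t n by case: (hp n).
have ht' n : n.+1%:R <= t' n.
  case: (hp n) => h1 /andP[h2 _] _; apply: le_trans h1 _.
  by rewrite ler_peMl// (le_trans _ (ht n)).
have t0 n : 0 < t n by apply: lt_le_trans (ht n); rewrite ltr0n.
have t0' n : 0 < t' n by apply: lt_le_trans (ht' n); rewrite ltr0n.
have mV s n : (forall n, 0 < s n) ->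
    measurable (bounded_ratio_set g k s n : set (lebesgueTypeR R)).
  move=> s0; apply: bigcap_measurable; first by exists n => /=.
  by move=> m _; exact: measurable_bounded_ratio.
have [n hn] := bounded_ratio_set_large rv ht.
have [n' hn'] := bounded_ratio_set_large rv ht'.
pose m := maxn n n'.
have big s i : (i <= m)%N -> (forall n, 0 < s n) ->
    ((5 / 2)%:E < mu (bounded_ratio_set g k s i))%E ->
    ((5 / 2)%:E < mu (bounded_ratio_set g k s m))%E.
  move=> im s0 /lt_le_trans; apply; apply: le_measure; rewrite ?inE; try exact: mV.
  exact: bounded_ratio_setS.
have hm := big t n (leq_maxl _ _) t0 hn.
have hm' := big t' n' (leq_maxr _ _) t0' hn'.
have [_ l12 bad] := hp m.
have [s [A B]] := large_sets_meet (mV _ m t0) (mV _ m t0') (@bounded_ratio_set_sub _ _ _ _)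
  (@bounded_ratio_set_sub _ _ _ _) l12 hm hm'.
apply: bad; rewrite -/(t m) -/(t' m).
have [_ /andP[A1 A2]] := A m (leqnn m).
have [_ /andP[]] := B m (leqnn m).
rewrite {2 4}/t' mulrA (mulrC s) -/(t m) => B1 B2.
move: A1 B1; rewrite !ler_pdivrMl// => A1 B1.
split.
  by apply: le_trans B1 _; rewrite expr2 -mulrA ler_pM2l.
by apply: le_trans A1 _; rewrite expr2 -mulrA ler_pM2l.
Qed.

End RegularVariation.

(** * Potter bounds *)

Section Potter.
Context {R : realType}.

Definition potter_bounds (g : R -> R) (C X : R) (M : nat) :=
  forall s t, X <= s -> s <= t ->
    g s <= C * (t / s) ^+ M * g t /\ g t <= C * (t / s) ^+ M * g s.

Lemma geometric_block (r s : R) : 1 < r -> 1 <= s ->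
  exists n, r ^+ n <= s < r ^+ n.+1.
Proof.
move=> r1 s1; have ex : exists n, s < r ^+ n.+1.
  pose n := Num.truncn (s / (r - 1)); exists n.
  have rm : 0 < r - 1 by rewrite subr_gt0.
  have H : s / (r - 1) < n.+1%:R by exact: truncnS_gt.
  have {H}H : s < n.+1%:R * (r - 1) by rewrite -ltr_pdivrMr.
  apply: lt_le_trans H _; elim: n.+1 => [|m IH]; first by rewrite mul0r.
  have h1 : 1 <= r ^+ m by rewrite exprn_ege1// ltW.
  by rewrite exprS -(natr1 m); nra.
case: (ex_minnP ex) => n sn min; exists n; rewrite sn andbT.
case: n sn min => [|n] sn min; first by rewrite expr0.
by rewrite leNgt; apply/negP => /min; rewrite ltnn.
Qed.

(** Iterating the uniform bound along doublings costs a factor K for each of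
    the log2(t/s) steps, which is a power of t/s once K <= 2^M. *)
Lemma potter_of_rv (eta : R) (g : R -> R) : regularly_varying eta g ->
  exists C X M, [/\ 1 <= C, 0 < X & potter_bounds g C X M].
Proof.
move=> rv; have [_ g0 _] := rv.
have [K [X [K1 X0 H]]] := uniform_bound rv.
pose M := Num.truncn K.
have KM : K <= 2 ^+ M.
  have : K < M.+1%:R by exact: truncnS_gt.
  move=> /ltW/le_trans; apply.
  by rewrite -natrX ler_nat ltn_expl.
exists K, X, M; split => // s t Xs st.
have s0 : 0 < s by exact: lt_le_trans Xs.
have [||n /andP[_]] := @geometric_block 2 (t / s); first by lra.
  by rewrite ler_pdivlMr ?mul1r.
rewrite ltr_pdivrMr//; elim: n s s0 Xs st => [|n IH] s s0 Xs st tn.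
all: have gs : 0 < g s by apply: g0; lra.
all: have gt : 0 < g t by apply: g0; lra.
all: have p1 : 1 <= (t / s) ^+ M by rewrite exprn_ege1// ler_pdivlMr// mul1r.
all: have base : t <= 2 * s ->
  g s <= K * (t / s) ^+ M * g t /\ g t <= K * (t / s) ^+ M * g s.
1,3: move=> t2s; have [|H1 H2] := H s (t / s) Xs;
  [by rewrite ler_pdivlMr// ler_pdivrMr// mul1r st|];
  rewrite divfK ?gt_eqF// in H1 H2;
  split; [apply: le_trans H2 _|apply: le_trans H1 _];
  rewrite ler_pM2r// ler_peMr//; lra.
  by apply: base; rewrite ltW.
have [st2|ts2] := leP (2 * s) t; last by apply: base; rewrite ltW.
have [||||H1 H2] := IH (2 * s); rewrite ?mulr_gt0//.
- by lra.
- by move: tn; rewrite exprS -mulrA mulrCA.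
have [|H3 H4] := H s 2 Xs; first by rewrite lexx andbT; lra.
have E : (t / (2 * s)) ^+ M * 2 ^+ M = (t / s) ^+ M.
  by rewrite -exprMn; congr (_ ^+ _); field; rewrite gt_eqF.
have p0 : 0 <= (t / (2 * s)) ^+ M by rewrite exprn_ge0// divr_ge0//; lra.
have E' : (t / (2 * s)) ^+ M * K <= (t / s) ^+ M by rewrite -E ler_wpM2l.
have K0 : 0 < K by lra.
split.
  apply: le_trans H4 _; rewrite -!mulrA ler_pM2l//; apply: le_trans H1 _.
  by rewrite [K * _]mulrC ler_pM2r.
apply: le_trans H2 _; rewrite -!mulrA ler_pM2l//.
apply: le_trans (_ : (t / (2 * s)) ^+ M * (K * g s) <= _); first by rewrite ler_wpM2l.
by rewrite mulrA ler_pM2r.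
Qed.

End Potter.

(** * The maximum principle and the relaxation equation *)

Section MaximumPrinciple.
Context {R : realType}.
Implicit Types (v : R -> R).

Let le_of_eq (x y : R) : x = y -> x <= y. Proof. by move->. Qed.

(** The larger value lies to the left, so this excludes a maximum over [S,T]
    with negative derivative even at the right end point T. *)
Lemma neg_derive_left v (S t d : R) : is_derive t 1 v d -> d < 0 -> S < t ->
  exists2 s, S < s < t & v t < v s.
Proof.
move=> [dv dE] d0 St.
have : h^-1 *: ((v \o shift t) (h *: 1) - v t) @[h --> 0^'] --> d by rewrite -dE.
move=> /cvgrPdist_lt /(_ (- d)); rewrite oppr_gt0 => /(_ d0) [e /= e0 H].
(* a step to the left, short enough to stay beyond S *)
pose h := - Num.min (e / 2) ((t - S) / 2).
have tS : 0 < (t - S) / 2 by lra.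
have e2 : 0 < e / 2 by lra.
have h0 : h < 0 by rewrite oppr_lt0 lt_min e2 tS.
have hS : - h <= (t - S) / 2 by rewrite opprK ge_min lexx orbT.
have he : - h <= e / 2 by rewrite opprK ge_min lexx.
exists (h + t); first by apply/andP; split; lra.
have /H : ball 0 e h by rewrite /ball /= sub0r normrN ltr0_norm//; lra.
rewrite lt_eqF// => /(_ isT); rewrite /= -[h *: 1]/(h * 1) mulr1 -[_ *: _]/(_ * _).
rewrite ltr_norml => /andP[H1 _].
have : h^-1 * (v (h + t) - v t) < 0 by lra.
by rewrite nmulr_rlt0 ?invr_lt0// subr_gt0.
Qed.

Lemma derivable_bounded v (S T : R) :
  (forall t, S <= t <= T -> derivable v t 1) ->
  exists B, forall t, S <= t <= T -> `|v t| <= B.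
Proof.
move=> dv; have cv : {within `[S, T], continuous v}.
  by apply: derivable_within_continuous => t; rewrite in_itv/=; exact: dv.
have [ST|TS] := leP S T; last by exists 0 => t /andP[? ?]; lra.
have [c1 _ H1] := EVT_max ST cv; have [c2 _ H2] := EVT_min ST cv.
exists (`|v c1| + `|v c2|) => t tI; rewrite ler_norml.
have := H1 t; have := H2 t; rewrite !in_itv/= => /(_ tI) + /(_ tI).
have := ler_norm (v c1); have := ler_norm (- v c2); rewrite normrN.
have := normr_ge0 (v c1); have := normr_ge0 (v c2); lra.
Qed.

(** At a maximum above the level K the derivative would be negative. *)
Lemma barrier v (d : R -> R) (S T K : R) : S <= T ->
  (forall t, S <= t <= T -> is_derive t 1 v (d t)) -> v S <= K ->
  (forall t, S <= t <= T -> K < v t -> d t < 0) -> v T <= K.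
Proof.
move=> ST dv vS H.
have cv : {within `[S, T], continuous v}.
  by apply: derivable_within_continuous => t; rewrite in_itv/= => /dv[].
have [c cI vc] := EVT_max ST cv; move: (cI); rewrite in_itv/= => cST.
have TI : T \in `[S, T] by rewrite in_itv/= ST lexx.
apply: le_trans (vc _ TI) _; rewrite leNgt; apply/negP => Kc.
have [Sc|cS] := ltP S c; last first.
  have E : c = S by case/andP: cST; lra.
  by move: Kc; rewrite E ltNge vS.
have [s /andP[s1 s2] /lt_geF] := neg_derive_left (dv _ cST) (H _ cST Kc) Sc.
rewrite vc// in_itv/= ltW//= (le_trans (ltW s2))//.
by case/andP: cST.
Qed.

Lemma barrier_norm v (c p : R -> R) (S T K c0 P : R) : S <= T -> 0 < c0 ->
  (forall t, S <= t <= T -> is_derive t 1 v (- c t * v t + p t)) ->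
  (forall t, S <= t <= T -> c0 <= c t) ->
  (forall t, S <= t <= T -> `|p t| <= P) ->
  `|v S| <= K -> P <= c0 * K -> `|v T| <= K.
Proof.
move=> ST c00 dv hc hp vS PK.
have K0 : 0 <= K by exact: le_trans vS.
have E w (r : R -> R) : (forall t, S <= t <= T -> is_derive t 1 w (- c t * w t + r t)) ->
    (forall t, S <= t <= T -> `|r t| <= P) -> `|w S| <= K -> w T <= K.
  move=> dw hr wS; apply: (barrier ST dw); first exact: le_trans (ler_norm _) wS.
  move=> t tI Kw; have := hc _ tI; have := hr _ tI; have := ler_norm (r t).
  by nra.
rewrite ler_norml; apply/andP; split; last exact: (E v p).
rewrite lerNl; apply: (E (- v) (- p)).
- move=> t tI; have -> : - c t * (- v) t + (- p) t = - (- c t * v t + p t).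
    by rewrite -[(- v) t]/(- v t) -[(- p) t]/(- p t); ring.
  by have := dv _ tI => dvt; exact: is_deriveN.
- by move=> t tI; rewrite -[(- p) t]/(- p t) normrN; exact: hp.
- by rewrite -[(- v) S]/(- v S) normrN.
Qed.

Lemma is_derive_weight v (m t d : R) : 0 < t -> is_derive t 1 v d ->
  is_derive t 1 (fun s => s `^ m * v s) (t `^ m * (m / t * v t + d)).
Proof.
move=> t0 dv; have dp := is_derive1_powR m t0.
have -> : t `^ m * (m / t * v t + d) =
    t `^ m *: d + v t *: (m * t `^ (m - 1)).
  rewrite -![_ *: _]/(_ * _) powRB ?(gt_eqF t0) ?implybT//.
  by rewrite powRr1 ?ltW//; field; rewrite gt_eqF.
exact: is_deriveM.
Qed.

(** With N = M + 1, the weight t^N turns the Potter bound for g into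
    s^N g(s) <= C t^N g(t), and t^N g(t) even tends to infinity, so that it
    eventually dominates the initial value in the maximum principle whatever e
    is.  The constant 2C does not depend on e, which is what makes the lemma
    serve both O and o. *)
Lemma relaxation (g w p : R -> R) (C X : R) (M : nat) :
  1 <= C -> 0 < X -> (forall t : R, 0 <= t -> 0 < g t) -> potter_bounds g C X M ->
  (forall t : R, 0 < t -> is_derive t 1 w (- w t + p t)) ->
  forall e, 0 < e -> (\forall t \near +oo, `|p t| <= e * g t) ->
  \forall t \near +oo, `|w t| <= 2 * C * e * g t.
Proof.
move=> C1 X0 g0 pot dw e e0 [T1 [_ Hp]].
pose N : R := M.+1%:R.
have N0 : 0 < N by rewrite ltr0n.
pose S := Num.max 1 (Num.max X (Num.max (2 * N) (T1 + 1))).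
have [S1 SX SN ST1] : [/\ 1 <= S, X <= S, 2 * N <= S & T1 < S].
  by rewrite /S !le_max !lt_max !lexx !orbT; split => //; rewrite ltrDl ltr01 !orbT.
have C0 : 0 < C by lra.
have S0 : 0 < S by lra.
pose v := fun s => s `^ N * w s.
have dv t : S <= t -> is_derive t 1 v (- (1 - N / t) * v t + t `^ N * p t).
  move=> St; have t0 : 0 < t by lra.
  have -> : - (1 - N / t) * v t + t `^ N * p t =
     t `^ N * (N / t * w t + (- w t + p t)) by rewrite /v; ring.
  by apply: is_derive_weight => //; exact: dw.
have gS : 0 < g S by apply: g0; lra.
(* beyond A, the weighted bound dominates the initial value at S *)
pose A := `|v S| / (C * e * (S ^+ M * g S / C)).
have key s t : S <= s -> s <= t -> s ^+ M * g s <= C * (t ^+ M * g t).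
  move=> Ss st; have s0 : 0 < s by lra.
  have [H _] := pot s t (le_trans SX Ss) st.
  have sM : 0 < s ^+ M by rewrite exprn_gt0.
  rewrite mulrC -ler_pdivlMr//; apply: le_trans H _.
  by rewrite expr_div_n; apply: le_of_eq; field; rewrite gt_eqF.
exists (Num.max S A); split; first by rewrite num_real.
move=> t /=; rewrite gt_max => /andP[St At].
have t0 : 0 < t by lra.
have gt : 0 < g t by apply: g0; lra.
have tM : 0 < t ^+ M by rewrite exprn_gt0.
have tN u : 0 < u -> u `^ N = u * u ^+ M.
  by move=> u0; rewrite powR_mulrn ?ltW// exprS.
have : `|v t| <= 2 * C * e * (t * (t ^+ M * g t)).
  apply: (@barrier_norm v (fun s => 1 - N / s) (fun s => s `^ N * p s) S t _
    (1/2) (C * e * (t * (t ^+ M * g t)))) => //; first by rewrite ltW.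
  - by move=> s /andP[Ss _]; exact: dv.
  - move=> s /andP[Ss _]; have s0 : 0 < s by lra.
    suff : N / s <= 1 / 2 by lra.
    by rewrite ler_pdivrMr//; lra.
  - move=> s /andP[Ss st]; have s0 : 0 < s by lra.
    rewrite tN// !normrM (gtr0_norm s0) gtr0_norm ?exprn_gt0//.
    have /Hp hp : T1 < s by lra.
    have sM : 0 < s ^+ M by rewrite exprn_gt0.
    have k := key _ _ Ss st.
    have h1 : s ^+ M * `|p s| <= s ^+ M * (e * g s) by rewrite ler_pM2l.
    have h2 : e * (s ^+ M * g s) <= e * (C * (t ^+ M * g t)) by rewrite ler_pM2l.
    have h3 : s ^+ M * `|p s| <= e * (C * (t ^+ M * g t)) by lra.
    rewrite -mulrA; apply: le_trans (_ : s * (e * (C * (t ^+ M * g t))) <= _).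
      by rewrite ler_pM2l.
    have q0 : 0 <= e * (C * (t ^+ M * g t)) by rewrite !mulr_ge0// ltW.
    by apply: le_trans (ler_wpM2r q0 st) _; apply: le_of_eq; ring.
  - have k := key _ _ (lexx S) (ltW St).
    have D0 : 0 < C * e * (S ^+ M * g S / C).
      by rewrite !mulr_gt0// ?invr_gt0 ?exprn_gt0.
    move: At; rewrite /A ltr_pdivrMr// => At.
    apply: le_trans (ltW At) _.
    have k' : S ^+ M * g S / C <= t ^+ M * g t by rewrite ler_pdivrMr// [leRHS]mulrC.
    have q0 : 0 <= C * e * t by rewrite !mulr_ge0// ltW.
    have := ler_wpM2l q0 k'.
    have : 0 <= C * e * t * (t ^+ M * g t) by rewrite !mulr_ge0// ltW.
    lra.
  - by apply: le_of_eq; field.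
rewrite /v tN// !normrM (gtr0_norm t0) (gtr0_norm tM) => H.
rewrite -(ler_pM2l tM) -(ler_pM2l t0).
apply: le_trans (_ : _ <= 2 * C * e * (t * (t ^+ M * g t))) _.
  by rewrite mulrA.
by apply: le_of_eq; ring.
Qed.

End MaximumPrinciple.

(** * Growth of solutions of the pantograph equation *)

Section PantographGrowth.
Context {R : realType}.

Lemma geometric_sum_le (q : R) (n : nat) : 0 < q -> q < 1 ->
  \sum_(j < n) q ^+ j <= (1 - q)^-1.
Proof.
move=> q0 q1; have p : 0 < 1 - q by rewrite subr_gt0.
rewrite -[leRHS]mul1r ler_pdivlMr// mulrC.
have := subrX1 q n; have : 0 < q ^+ n by rewrite exprn_gt0.
lra.
Qed.

Let powRN_cancel (x k : R) : 0 < x -> x `^ k * x `^ (- k) = 1.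
Proof. by move=> x0; rewrite powRN divff// gt_eqF// powR_gt0. Qed.

(** The induction runs over the blocks from T_n to T_(n+1) = T_n / q: when t
    is in such a block, qt is in a block that has already been treated.  The
    hypothesis on q^k makes the weighted delay coefficient equal in size to the
    damping, and the defect k/t of the damping costs a factor 1 + 2 d0 q^n. *)
Lemma pantograph_growth (q a b k T0 : R) (z h : R -> R) (H : nat -> R) :
  0 < q -> q < 1 -> b < 0 -> 0 < T0 -> `|a| * q `^ k = - b ->
  2 * `|k| <= - b * T0 ->
  (forall t : R, 0 < t -> is_derive t 1 z (a * z (q * t) + b * z t + h t)) ->
  (forall n, 0 <= H n) ->
  (forall n t, T0 / q ^+ n <= t <= T0 / q ^+ n.+1 -> `|h t| <= H n * t `^ k) ->
  exists2 C, 0 < C & forall n t, T0 <= t <= T0 / q ^+ n ->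
    `|z t| <= C * t `^ k * (1 + \sum_(j < n) H j).
Proof.
move=> q0 q1 b0 T00 aqk kT dz H0 hh.
have qn n : 0 < q ^+ n by rewrite exprn_gt0.
pose T n := T0 / q ^+ n.
have Tp n : 0 < T n by rewrite divr_gt0.
have TS n : q * T n.+1 = T n.
  by rewrite /T exprS; field; rewrite !gt_eqF.
have TT0 n : T0 <= T n.
  by rewrite ler_pdivlMr// ler_piMr ?(ltW T00)// exprn_ile1// ltW.
pose u t := t `^ (- k) * z t.
pose d0 := `|k| / (- b * T0).
have bT : 0 < - b * T0 by rewrite mulr_gt0// oppr_gt0.
have d0p : 0 <= d0 by rewrite divr_ge0// ltW.
have d0h : d0 <= 1 / 2 by rewrite ler_pdivrMr//; lra.
pose p (s : R) : R := a * q `^ k * u (q * s) + s `^ (- k) * h s.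
have du (t : R) : 0 < t -> is_derive t 1 u (- (- b + k / t) * u t + p t).
  move=> t0; have -> : - (- b + k / t) * u t + p t =
      t `^ (- k) * (- k / t * z t + (a * z (q * t) + b * z t + h t)).
    rewrite /p /u powRM ?ltW//.
    have -> : a * q `^ k * (q `^ (- k) * t `^ (- k) * z (q * t)) =
        (q `^ k * q `^ (- k)) * a * t `^ (- k) * z (q * t) by ring.
    by rewrite powRN_cancel//; ring.
  by apply: is_derive_weight => //; exact: dz.
have [B HB] : exists B, forall t, q * T0 <= t <= T0 -> `|u t| <= B.
  apply: derivable_bounded => t /andP[qt _].
  have t0 : 0 < t by apply: lt_le_trans qt; rewrite mulr_gt0.
  by case: (du t t0).
have B0 : 0 <= B.
  by apply: le_trans (HB T0 _); rewrite // lexx andbT ler_piMl// ltW.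
pose Sg n := \sum_(j < n) H j.
have Sg0 n : 0 <= Sg n by apply: sumr_ge0 => j _.
(* E n bounds the product of the factors 1 + 2 d0 q^j for j < n *)
pose E n := expR (2 * d0 * \sum_(j < n) q ^+ j).
have E1 n : 1 <= E n.
  have : 0 <= \sum_(j < n) q ^+ j by rewrite sumr_ge0// => j _; exact: ltW.
  by move=> S0; rewrite -expR0 ler_expR mulr_ge0// mulr_ge0.
pose D := 2 / - b.
have D0 : 0 < D by rewrite divr_gt0// oppr_gt0.
pose U n := E n * (B + D * Sg n).
have U0 n : 0 <= U n.
  rewrite mulr_ge0 ?(le_trans ler01 (E1 n))// addr_ge0// mulr_ge0//; exact: ltW.
have US n : (1 + 2 * d0 * q ^+ n) * U n + D * H n <= U n.+1.
  have ES : E n.+1 = E n * expR (2 * d0 * q ^+ n).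
    by rewrite /E big_ord_recr/= mulrDr expRD.
  have e1 : 1 + 2 * d0 * q ^+ n <= expR (2 * d0 * q ^+ n).
    exact: expR_ge1Dx.
  have -> : U n.+1 = expR (2 * d0 * q ^+ n) * U n + E n.+1 * (D * H n).
    by rewrite /U /Sg big_ord_recr/= ES; ring.
  by rewrite lerD ?ler_wpM2r// ler_peMl// mulr_ge0// ltW.
have claim n t : q * T0 <= t <= T n -> `|u t| <= U n.
  elim: n t => [|n IH] t /andP[qt tT].
    rewrite /U /E /Sg !big_ord0 !mulr0 expR0 mul1r addr0; apply: HB.
    by rewrite qt; move: tT; rewrite /T expr0 divr1.
  have dq0 : 0 <= d0 * q ^+ n by rewrite mulr_ge0// ltW.
  have dq : d0 * q ^+ n <= 1 / 2.
    by apply: le_trans d0h; rewrite ler_piMr// exprn_ile1// ltW.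
  have Umon : U n <= U n.+1.
    apply: le_trans (US n); have := mulr_ge0 (ltW D0) (H0 n).
    by have := mulr_ge0 dq0 (U0 n); lra.
  have [tn|nt] := leP t (T n).
    by apply: le_trans (IH t _) Umon; rewrite qt.
  have kTn : `|k| / T n = - b * (d0 * q ^+ n).
    rewrite /d0 /T; field.
    by rewrite (lt_eqF b0) (gt_eqF T00) ?(gt_eqF (qn n)).
  apply: (@barrier_norm _ u (fun s => - b + k / s) p (T n) t (U n.+1)
    (- b - `|k| / T n) (- b * U n + H n)).
  - exact: ltW.
  - by rewrite kTn; nra.
  - by move=> s /andP[Ts _]; apply: du; exact: lt_le_trans Ts.
  - move=> s /andP[Ts _]; have s0 : 0 < s by exact: lt_le_trans Ts.
    rewrite lerD2l lerNl.
    apply: le_trans (ler_norm _) _; rewrite normrN normrM normfV (gtr0_norm s0).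
    by rewrite ler_wpM2l// lef_pV2// posrE.
  - move=> s /andP[Ts st]; have s0 : 0 < s by exact: lt_le_trans Ts.
    apply: le_trans (ler_normD _ _) _; apply: lerD.
      rewrite normrM normrM (gtr0_norm (powR_gt0 _ q0)) aqk; apply: ler_wpM2l; [lra|apply: IH].
      rewrite ler_pM2l// (le_trans (TT0 n))//= -TS ler_pM2l//.
      exact: le_trans tT.
    rewrite normrM gtr0_norm ?powR_gt0//.
    have /hh : T0 / q ^+ n <= s <= T0 / q ^+ n.+1 by rewrite Ts (le_trans st).
    move=> hs; rewrite powRN mulrC ler_pdivrMr ?powR_gt0//.
  - by apply: le_trans (IH _ _) Umon; rewrite lexx andbT (le_trans _ (TT0 n))// ler_piMl// ltW.
  - rewrite kTn.
    have -> : - b - - b * (d0 * q ^+ n) = - b * (1 - d0 * q ^+ n) by ring.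
    have c0 : 0 <= - b * (1 - d0 * q ^+ n) by rewrite mulr_ge0; lra.
    apply: le_trans (ler_wpM2l c0 (US n)).
    set d := d0 * q ^+ n in dq dq0 *.
    have -> : 2 * d0 * q ^+ n = 2 * d by rewrite /d; ring.
    have -> : - b * (1 - d) * ((1 + 2 * d) * U n + D * H n) =
      - b * U n + H n + (- b * U n) * (d * (1 - 2 * d)) + H n * (1 - 2 * d).
      by rewrite /D; field; rewrite lt_eqF.
    have h1 : 0 <= - b * U n * (d * (1 - 2 * d)).
      by apply: mulr_ge0; apply: mulr_ge0 => //; lra.
    have h2 : 0 <= H n * (1 - 2 * d) by apply: mulr_ge0 => //; lra.
    by lra.
pose Einf := expR (2 * d0 * (1 - q)^-1).
have Einf0 : 0 < Einf by exact: expR_gt0.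
exists (Einf * (B + D + 1)).
  by rewrite mulr_gt0//; lra.
move=> n t /andP[T0t tT]; have t0 : 0 < t by lra.
have tk : 0 < t `^ k by exact: powR_gt0.
have -> : z t = t `^ k * u t.
  by rewrite /u mulrA powRN_cancel// mul1r.
rewrite normrM (gtr0_norm tk) mulrAC [leLHS]mulrC ler_pM2r//.
apply: le_trans (claim n t _) _.
  by rewrite tT andbT (le_trans _ T0t)// ler_piMl// ltW.
have EE : E n <= Einf.
  rewrite ler_expR; apply: ler_wpM2l; first by rewrite mulr_ge0.
  exact: geometric_sum_le.
apply: le_trans (_ : Einf * (B + D * Sg n) <= _).
  by rewrite ler_wpM2r// addr_ge0// mulr_ge0// ltW.
rewrite -[leRHS]mulrA ler_pM2l// -/(Sg n).
have := Sg0 n; nra.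
Qed.

End PantographGrowth.

(** * Asymptotic comparison and the two perturbation estimates *)

Section Landau.
Context {R : realType}.
Implicit Types (x g : R -> R).

(** The common form, with an explicit constant, of O, o and a bounded limsup;
    no absolute value on g, which is positive in all uses. *)
Definition eventually_le x g (e : R) := \forall t \near +oo, `|x t| <= e * g t.

Lemma eqO_pinftyP x g : (forall t : R, 0 < t -> 0 < g t) ->
  x =O_+oo g <-> exists2 K, 0 < K & eventually_le x g K.
Proof.
move=> g0; split.
  move=> /eqOP [K [_ H]].
  exists (Num.max 1 (K + 1)); first by rewrite lt_max ltr01.
  have /H : K < Num.max 1 (K + 1) by rewrite lt_max ltrDl ltr01 orbT.
  move=> [T [Tr HT]]; exists (Num.max T 0); split; first by rewrite num_real.
  move=> t; rewrite gt_max => /andP[/HT /= + t0].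
  by rewrite (gtr0_norm (g0 t t0)).
move=> [K K0 [T [Tr HT]]]; apply/eqOP; exists K; split; first exact: num_real.
move=> K' KK'; exists (Num.max T 0); split; first by rewrite num_real.
move=> t /=; rewrite gt_max => /andP[/HT /= + t0].
move=> /le_trans; apply; rewrite (gtr0_norm (g0 t t0)) ler_pM2r ?g0//.
exact: ltW.
Qed.

Lemma eqo_pinftyP x g : (forall t : R, 0 < t -> 0 < g t) ->
  x =o_+oo g <-> forall e, 0 < e -> eventually_le x g e.
Proof.
move=> g0; rewrite eqoP; split => H e e0.
  have [T [Tr HT]] := H e e0; exists (Num.max T 0); split; first by rewrite num_real.
  move=> t /=; rewrite gt_max => /andP[/HT /= + t0].
  by rewrite (gtr0_norm (g0 t t0)).
have [T [Tr HT]] := H e e0; exists (Num.max T 0); split; first by rewrite num_real.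
move=> t /=; rewrite gt_max => /andP[/HT /= + t0].
by rewrite (gtr0_norm (g0 t t0)).
Qed.

Lemma limsup_ratio_gt0P x g : (forall t : R, 0 < t -> 0 < g t) ->
  ~ (0 < limsup_ratio x g)%E <-> forall e, 0 < e -> eventually_le x g e.
Proof.
move=> g0; split.
  move=> /negP; rewrite -leNgt => H e e0.
  have : (limsup_ratio x g < e%:E)%E by apply: le_lt_trans H _; rewrite lte_fin.
  rewrite /limsup_ratio limf_esupE => /ereal_inf_lt [_ [V [T [Tr HT]] <-] sV].
  exists (Num.max T 0); split; first by rewrite num_real.
  move=> t /=; rewrite gt_max => /andP[/HT Vt t0].
  rewrite -ler_pdivrMr ?g0// -lee_fin; apply: le_trans (ltW sV).
  by apply: ereal_sup_ubound; exists t.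
move=> H; apply/negP; rewrite -leNgt; apply/lee_addgt0Pr => e e0; rewrite add0e.
have [T [Tr HT]] := H e e0.
rewrite /limsup_ratio limf_esupE; apply: ereal_inf_le.
exists (ereal_sup ((fun t => (`|x t| / g t)%:E) @` [set t | Num.max T 0 < t])).
  exists [set t | Num.max T 0 < t] => //.
  by exists (Num.max T 0); split => //; rewrite num_real.
apply: ge_ereal_sup => _ [t /= + <-]; rewrite gt_max => /andP[/HT /= h t0].
by rewrite lee_fin ler_pdivrMr ?g0.
Qed.

End Landau.

Section Kappa.
Context {R : realType}.
Variables (q a b : R).
Hypotheses (q0 : 0 < q) (q1 : q < 1) (a0 : a != 0) (b0 : b < 0).

Lemma powR_kappa : `|a| * q `^ kappa q a b = - b.
Proof.
have na : 0 < `|a| by rewrite normr_gt0.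
have lq : ln q < 0 by rewrite ln_lt0// q0.
have ba : 0 < `|b / a| by rewrite normr_gt0 mulf_neq0 ?invr_eq0// lt_eqF.
rewrite /powR gt_eqF// /kappa lnV ?posrE//.
have -> : - ln `|b / a| / - ln q * ln q = ln `|b / a|.
  by field; rewrite lt_eqF.
rewrite lnK ?posrE// normrM normfV (ltr0_norm b0) mulrCA divff ?mulr1//.
by rewrite gt_eqF.
Qed.

Lemma kappa_lt0 : `|a| < `|b| -> kappa q a b < 0.
Proof.
move=> ab; have na : 0 < `|a| by rewrite normr_gt0.
rewrite /kappa mulNr oppr_lt0 divr_gt0// ln_gt0//.
  by rewrite normrM normfV ltr_pdivlMr// mul1r.
by rewrite invf_gt1.
Qed.

End Kappa.

Section PantographBounds.
Context {R : realType}.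
Variables (g : R -> R) (C X q : R) (M : nat).
Hypotheses (C1 : 1 <= C) (X0 : 0 < X) (g0 : forall t : R, 0 <= t -> 0 < g t).
Hypotheses (pot : potter_bounds g C X M) (q0 : 0 < q) (q1 : q < 1).

Let C0 : 0 < C. Proof. by apply: lt_le_trans C1. Qed.

Lemma delay_bound (a c : R) : exists2 D, 0 < D & forall (x : R -> R) e, 0 < e ->
  eventually_le x g e -> eventually_le (fun t => a * x (q * t) + c * x t) g (D * e).
Proof.
have qM : 0 < q^-1 ^+ M by rewrite exprn_gt0 ?invr_gt0.
exists (`|a| * (C * q^-1 ^+ M) + `|c| + 1).
  have CM : 0 <= `|a| * (C * q^-1 ^+ M).
    by rewrite mulr_ge0// mulr_ge0 ?(ltW qM)//; apply: le_trans C1.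
  by have := normr_ge0 c; lra.
move=> x e e0 [T [Tr HT]].
pose S := Num.max X (Num.max T 0).
exists (S / q); split; first by rewrite num_real.
move=> t /=; rewrite ltr_pdivrMr// mulrC /S !gt_max => /and3P[Xt Tt t0].
have t1 : q * t < t.
  by move: t0; rewrite pmulr_rgt0// => t0; rewrite gtr_pMl.
have [H _] := pot (ltW Xt) (ltW t1).
have tq : t / (q * t) = q^-1.
  by field; rewrite !gt_eqF// (lt_trans t0).
rewrite tq in H.
have h1 := HT _ Tt; have h2 := HT _ (lt_trans Tt t1); rewrite /= in h1 h2.
apply: le_trans (ler_normD _ _) _; rewrite !normrM.
have gt : 0 < g t by apply: g0; lra.
have e1 := ler_wpM2l (normr_ge0 a) h1; have e2 := ler_wpM2l (normr_ge0 c) h2.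
have e3 : `|a| * (e * g (q * t)) <= `|a| * (e * (C * q^-1 ^+ M * g t)).
  by rewrite ler_wpM2l// ler_pM2l.
have : 0 < e * g t by rewrite mulr_gt0.
lra.
Qed.

(** The difference w = y - x no longer sees f: it solves w' = - w + p with
    p(t) = - a x(qt) - (b+1) x(t). *)
Lemma perturbation_bound (a b zeta : R) (f x y : R -> R) :
  pantograph_solution q a b f zeta x -> perturbation_solution f y ->
  exists2 D, 0 < D & forall e, 0 < e ->
    eventually_le x g e -> eventually_le y g (D * e).
Proof.
move=> [_ _ _ dx] [_ _ _ dy].
have [D D0 HD] := delay_bound (- a) (- (b + 1)).
exists (1 + 2 * C * D); first by rewrite ltr_wpDr// !mulr_ge0// ltW.
move=> e e0 xe; pose p t := - a * x (q * t) + - (b + 1) * x t.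
have dw (t : R) : 0 < t -> is_derive t 1 (y - x) (- (y - x) t + p t).
  move=> t0; have -> : - (y - x) t + p t =
      - y t + f t - (a * x (q * t) + b * x t + f t).
    by rewrite /p -[(y - x) t]/(y t - x t); ring.
  by have := dx _ t0; have := dy _ t0 => h1 h2; exact: is_deriveB.
have De : 0 < D * e by rewrite mulr_gt0.
have H1 := relaxation C1 X0 g0 pot dw De (HD x e e0 xe).
apply: filterS2 xe H1 => t h1; rewrite -[(y - x) t]/(y t - x t) => h2.
have -> : y t = x t + (y t - x t) by ring.
by apply: le_trans (ler_normD _ _) _; lra.
Qed.

Variable k : R.
Hypothesis k0 : k < 0.
Let theta t := g t * t `^ (- k).

Lemma theta_gt0 t : 0 < t -> 0 < theta t.
Proof. by move=> t0; rewrite mulr_gt0 ?powR_gt0// g0// ltW. Qed.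

(** Over one block g changes by a bounded factor, by the Potter bounds, and so
    does the power of t. *)
Lemma theta_block : exists2 D, 1 <= D & forall T t, X <= T -> T <= t <= T / q ->
  theta t <= D * theta T /\ theta T <= D * theta t.
Proof.
have qi : 1 <= q^-1 by rewrite invf_ge1// ltW.
have mono s t : 0 < s -> s <= t -> s `^ (- k) <= t `^ (- k).
  by move=> s0 st; rewrite ge0_ler_powR ?nnegrE ?oppr_ge0 ?(ltW k0)//; lra.
pose Q := q^-1 `^ (- k).
have Q1 : 1 <= Q by have := mono _ _ ltr01 qi; rewrite powR1.
pose N := q^-1 ^+ M.
have N1 : 1 <= N by rewrite exprn_ege1.
exists (C * N * Q).
  have h : 1 <= C * N by rewrite -[1]mulr1 ler_pM.
  by rewrite -[1]mulr1 ler_pM.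
move=> T t XT /andP[Tt tT].
have T0 : 0 < T by exact: lt_le_trans XT.
have t0 : 0 < t by exact: lt_le_trans Tt.
have [H1 H2] := pot XT Tt.
have gT := g0 (ltW T0); have gt := g0 (ltW t0).
have r1 : (t / T) ^+ M <= N.
  rewrite lerXn2r ?nnegrE ?invr_ge0 ?divr_ge0 ?(ltW q0) ?(ltW t0) ?(ltW T0)//.
  by rewrite ler_pdivrMr// mulrC.
have w1 : C * (t / T) ^+ M <= C * N by rewrite ler_pM2l.
have w2 := ler_wpM2r (ltW gT) w1; have w3 := ler_wpM2r (ltW gt) w1.
have Tk : 0 < T `^ (- k) by exact: powR_gt0.
have tk : 0 < t `^ (- k) by exact: powR_gt0.
have m1 := mono _ _ T0 Tt; have := mono _ _ t0 tT.
rewrite powRM ?invr_ge0 ?(ltW q0) ?(ltW T0)// -/Q => m2.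
have CN : 0 < C * N by rewrite mulr_gt0//; exact: lt_le_trans N1.
rewrite /theta; split.
  apply: le_trans (_ : (C * N * g T) * (T `^ (- k) * Q) <= _).
    by apply: ler_pM; [exact: ltW|exact: ltW|exact: le_trans H2 w2|exact: m2].
  by rewrite le_eqVlt; apply/orP; left; apply/eqP; ring.
apply: le_trans (_ : (C * N * g t) * t `^ (- k) <= _).
  by apply: ler_pM; [exact: ltW|exact: ltW|exact: le_trans H1 w3|exact: m1].
have h : 0 <= C * N * g t * t `^ (- k) by rewrite !mulr_ge0// ltW// (lt_le_trans _ N1).
by have := ler_peMr h Q1; lra.
Qed.

Variables (a b zeta : R) (f x y : R -> R).
Hypotheses (b0 : b < 0) (aqk : `|a| * q `^ k = - b).
Hypotheses (hx : pantograph_solution q a b f zeta x).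
Hypotheses (hy : perturbation_solution f y).

(** Apply [pantograph_growth] to z = x - y, whose forcing is
    a y(qt) + (b+1) y(t).  The sum stops before the block that contains t, so
    that it can be compared with an integral up to t; the term of index n that
    this drops is absorbed by means of [theta_block]. *)
Lemma solution_growth K : 0 < K -> eventually_le y g K ->
  exists T, forall T0, T < T0 -> exists2 A, 0 < A &
  forall n t, T0 / q ^+ n <= t <= T0 / q ^+ n.+1 ->
    `|x t| <= A * t `^ k * (1 + \sum_(j < n) theta (T0 / q ^+ j)).
Proof.
move=> K0 yK; have [_ _ _ dx] := hx; have [_ _ _ dy] := hy.
have [B B0 HB] := delay_bound a (b + 1).
have [T1 [_ HT1]] := HB y K K0 yK; have [T2 [_ HT2]] := yK.
have [D D1 HD] := theta_block.
have D0 : 0 < D by exact: lt_le_trans D1.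
exists (Num.max X (Num.max T1 (Num.max T2 (2 * `|k| / - b)))) => T0.
rewrite !gt_max => /and4P[XT T1T T2T kT].
have T00 : 0 < T0 by exact: lt_trans XT.
have nb : 0 < - b by rewrite oppr_gt0.
rewrite ltr_pdivrMr// in kT.
have TT0 n : T0 <= T0 / q ^+ n.
  rewrite ler_pdivlMr ?exprn_gt0// ler_piMr ?(ltW T00)// exprn_ile1// ltW//.
have TS n : T0 / q ^+ n.+1 = T0 / q ^+ n / q.
  by rewrite exprSr; field; rewrite expf_eq0 !gt_eqF ?andbF.
pose th n := theta (T0 / q ^+ n).
have th0 n : 0 < th n by apply: theta_gt0; exact: lt_le_trans (TT0 n).
have blk n t : T0 / q ^+ n <= t <= T0 / q ^+ n.+1 -> g t <= D * th n * t `^ k.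
  move=> tI; have /andP[Tt _] := tI; rewrite TS in tI.
  have t0 : 0 < t by apply: lt_le_trans Tt; exact: lt_le_trans (TT0 n).
  have [h _] := HD _ t (le_trans (ltW XT) (TT0 n)) tI.
  have tk : 0 < t `^ k by exact: powR_gt0.
  rewrite -ler_pdivrMr//; apply: le_trans h.
  by rewrite /theta powRN.
pose h t := a * y (q * t) + (b + 1) * y t.
have dz (t : R) : 0 < t ->
    is_derive t 1 (x - y) (a * (x - y) (q * t) + b * (x - y) t + h t).
  move=> t0; have -> : a * (x - y) (q * t) + b * (x - y) t + h t =
      a * x (q * t) + b * x t + f t - (- y t + f t).
    by rewrite /h -![(x - y) _]/(x _ - y _); ring.
  by have := dx _ t0; have := dy _ t0 => h1 h2; exact: is_deriveB.
pose H n := B * K * D * th n.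
have BKD : 0 < B * K * D by rewrite !mulr_gt0.
have H0 n : 0 <= H n by exact: mulr_ge0 (ltW BKD) (ltW (th0 n)).
have hH n t : T0 / q ^+ n <= t <= T0 / q ^+ n.+1 -> `|h t| <= H n * t `^ k.
  move=> tI; have /andP[Tt _] := tI.
  have /HT1 /= ht : T1 < t by apply: lt_le_trans Tt; exact: lt_le_trans (TT0 n).
  apply: le_trans ht _; have -> : H n * t `^ k = B * K * (D * th n * t `^ k) by rewrite /H; ring.
  by rewrite ler_pM2l ?mulr_gt0//; exact: blk.
have kT' : 2 * `|k| <= - b * T0 by rewrite mulrC [- b * _]mulrC mulrC ltW.
have [A A0 HA] := pantograph_growth q0 q1 b0 T00 aqk kT' dz H0 hH.
pose S n := \sum_(j < n) th j.
have S0 n : 0 <= S n by apply: sumr_ge0 => j _; exact: ltW.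
have last n : th n <= D * (th 0 + S n).
  case: n => [|n].
    by rewrite /S big_ord0 addr0 ler_peMl// ltW.
  rewrite /S big_ord_recr/=.
  have [|h1 _] := HD _ (T0 / q ^+ n.+1) (le_trans (ltW XT) (TT0 n)).
    rewrite TS lexx andbT ler_pdivlMr// ler_piMr ?(ltW q1)// ltW//.
    exact: lt_le_trans (TT0 n).
  apply: le_trans h1 _; rewrite ler_pM2l// addrA lerDr addr_ge0 ?(ltW (th0 0%N))//.
  exact: S0.
pose L := th 0 + 1.
have L0 : 0 < L by rewrite addr_gt0.
have lastL n : th n <= D * L * (1 + S n).
  apply: le_trans (last n) _; rewrite -mulrA ler_pM2l//.
  by have := S0 n; have := th0 0%N; rewrite /L; nra.
exists (A * (1 + B * K * D * (1 + D * L)) + K * D * D * L).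
  by rewrite addr_gt0// !mulr_gt0// addr_gt0// mulr_gt0// addr_gt0// mulr_gt0.
move=> n t tI; have /andP[Tt tT] := tI.
have t0 : 0 < t by apply: lt_le_trans Tt; exact: lt_le_trans (TT0 n).
have tk : 0 < t `^ k by exact: powR_gt0.
have hy1 : `|y t| <= K * (D * th n * t `^ k).
  have /HT2 /= ht : T2 < t by apply: lt_le_trans Tt; exact: lt_le_trans (TT0 n).
  by apply: le_trans ht _; rewrite ler_pM2l//; exact: blk.
have hz := HA n.+1 t; rewrite tT (le_trans (TT0 n) Tt) in hz.
have {hz} := hz isT; rewrite -[(x - y) t]/(x t - y t) => hz.
have -> : x t = (x t - y t) + y t by ring.
apply: le_trans (ler_normD _ _) _; apply: le_trans (lerD hz hy1) _.
rewrite -mulr_sumr big_ord_recr/= -/(S n) -/(th _).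
have -> : A * t `^ k * (1 + B * K * D * (S n + th n)) + K * (D * th n * t `^ k) =
  t `^ k * (A * (1 + B * K * D * (S n + th n)) + K * D * th n) by ring.
have -> : (A * (1 + B * K * D * (1 + D * L)) + K * D * D * L) * t `^ k * (1 + S n) =
  t `^ k * ((A * (1 + B * K * D * (1 + D * L)) + K * D * D * L) * (1 + S n)) by ring.
rewrite ler_pM2l//.
have -> : (A * (1 + B * K * D * (1 + D * L)) + K * D * D * L) * (1 + S n) =
  A * ((1 + S n) + B * K * D * ((1 + S n) + D * L * (1 + S n))) +
  K * D * (D * L * (1 + S n)) by ring.
apply: lerD; last by rewrite ler_pM2l ?mulr_gt0.
rewrite ler_pM2l//; apply: lerD; first by rewrite lerDl.
rewrite ler_pM2l//; apply: lerD => //; by rewrite lerDr.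
Qed.

End PantographBounds.

(** * Weighted integrals and the main theorem *)

Section WeightedIntegral.
Context {R : realType}.
Local Notation mu := (@completed_lebesgue_measure R).
Variables (g : R -> R) (k : R).
Hypotheses (mg : measurable_fun (`[0, +oo[ : set (lebesgueTypeR R)) g)
  (g0 : forall t : R, 0 <= t -> 0 < g t).

Lemma weighted_ge0 t : 0 < t -> (0 <= weighted k g t)%E.
Proof. by move=> t0; rewrite lee_fin divr_ge0 ?powR_ge0// ltW// g0// ltW. Qed.

Lemma measurable_weighted (D : set (lebesgueTypeR R)) : measurable D ->
  D `<=` `[0, +oo[ -> measurable_fun D (weighted k g : lebesgueTypeR R -> \bar R).
Proof.
move=> mD D0; apply/measurable_EFinP.
have -> : (fun t => g t / t `^ (k + 1)) = (fun t => g t * t `^ (- (k + 1))).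
  by apply/funext => t; rewrite powRN.
apply: measurable_funM; first by apply: measurable_funS mg => //; exact: measurable_itv_completed.
have mid : measurable_fun setT (idfun : lebesgueTypeR R -> R).
  move=> _ B mB; rewrite setTI.
  exact: (@sub_caratheodory _ (ocitv_type R) R (wlength idfun)).
apply: measurable_funTS.
exact: (measurableT_comp (measurable_powR (- (k + 1))) mid).
Qed.

Let theta t := g t * t `^ (- k).

(** On the block the integrand theta(s)/s is at least
    (theta(T)/D) (q/T), and the block has length T (1-q)/q. *)
Lemma weighted_block (q D X : R) : 0 < q -> q < 1 -> 1 <= D -> 0 < X ->
  (forall T t, X <= T -> T <= t <= T / q ->
    theta t <= D * theta T /\ theta T <= D * theta t) ->
  forall T, X <= T ->
  (((1 - q) / D * theta T)%:E <= \int[mu]_(s in `]T, (T / q)%R]) weighted k g s)%E.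
Proof.
move=> q0 q1 D1 X0 H T XT.
have D0 : 0 < D by exact: lt_le_trans D1.
have T0 : 0 < T by exact: lt_le_trans XT.
have Tq : T < T / q by rewrite ltr_pdivlMr// gtr_pMr.
have thT : 0 < theta T by rewrite mulr_gt0 ?powR_gt0// g0// ltW.
(* lower bound of the integrand on the block *)
pose c := theta T * q / (D * T).
have -> : ((1 - q) / D * theta T)%:E = (c%:E * mu `]T, (T / q)%R])%E.
  rewrite -[mu _]/(lebesgue_measure `]T, (T / q)]%classic) lebesgue_measure_itv/=.
  rewrite lte_fin Tq -EFinB -EFinM; congr _%:E; rewrite /c; field.
  by rewrite !gt_eqF.
rewrite -integral_cst; last exact: measurable_itv_completed.
apply: ge0_le_integral.
- exact: measurable_itv_completed.
- by move=> s _; rewrite lee_fin divr_ge0// mulr_ge0// ltW.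
- exact: measurable_cst.
- apply: measurable_weighted; first exact: measurable_itv_completed.
  by move=> s /=; rewrite !in_itv/= andbT => /andP[Ts _]; lra.
- move=> s /=; rewrite in_itv/= => /andP[Ts sT]; rewrite lee_fin.
  have s0 : 0 < s by lra.
  have [|_ h] := H T s XT; first by rewrite sT ltW.
  have -> : g s / s `^ (k + 1) = theta s / s.
    rewrite powRD ?(gt_eqF s0) ?implybT// powRr1 ?ltW// /theta powRN invfM mulrA.
    by [].
  rewrite ler_pdivlMr// /c.
  have h2 : theta T / D <= theta s by rewrite ler_pdivrMr// mulrC.
  apply: le_trans h2.
  have -> : theta T * q / (D * T) * s = theta T / D * (q * s / T).
    by field; rewrite !gt_eqF.
  rewrite ler_piMr ?divr_ge0 ?(ltW D0) ?(ltW thT)//.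
  by rewrite ler_pdivrMr// mul1r mulrC -ler_pdivlMr.
Qed.

Lemma weighted_sum (q D X T0 : R) : 0 < q -> q < 1 -> 1 <= D -> 0 < X ->
  (forall T t, X <= T -> T <= t <= T / q ->
    theta t <= D * theta T /\ theta T <= D * theta t) -> X <= T0 -> forall n,
  (((1 - q) / D * \sum_(j < n) theta (T0 / q ^+ j))%:E <=
    \int[mu]_(s in `]T0, (T0 / q ^+ n)%R]) weighted k g s)%E.
Proof.
move=> q0 q1 D1 X0 H XT0; have T00 : 0 < T0 by exact: lt_le_trans XT0.
elim=> [|n IH].
  rewrite big_ord0 mulr0; apply: integral_ge0 => s /=; rewrite in_itv/= => /andP[Ts _].
  by apply: weighted_ge0; exact: lt_trans Ts.
have TT0 m : T0 <= T0 / q ^+ m.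
  by rewrite ler_pdivlMr ?exprn_gt0// ler_piMr ?(ltW T00)// exprn_ile1// ltW.
have TS : T0 / q ^+ n.+1 = T0 / q ^+ n / q.
  by rewrite exprSr; field; rewrite (gt_eqF q0) gt_eqF ?exprn_gt0.
have Tn0 : 0 < T0 / q ^+ n by exact: lt_le_trans (TT0 n).
have Tl : T0 / q ^+ n <= T0 / q ^+ n.+1.
  by rewrite TS ler_pdivlMr// ler_piMr// ltW.
have -> : `]T0, (T0 / q ^+ n.+1)]%classic =
    `]T0, (T0 / q ^+ n)] `|` `](T0 / q ^+ n), (T0 / q ^+ n.+1)].
  by rewrite -itv_bndbnd_setU// bnd_simp.
rewrite ge0_integral_setU; first last.
- rewrite disj_set2E; apply/eqP/seteqP; split => // s [/=].
  by rewrite !in_itv/= => /andP[_ s1] /andP[s2 _]; lra.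
- by move=> s [|] /=; rewrite in_itv/= => /andP[s1 _]; apply: weighted_ge0; lra.
- apply: measurable_weighted.
    by apply: measurableU; exact: measurable_itv_completed.
  by move=> s [|] /=; rewrite !in_itv/= andbT => /andP[s1 _]; lra.
- exact: measurable_itv_completed.
- exact: measurable_itv_completed.
rewrite big_ord_recr/= mulrDr EFinD; apply: leeD => //.
by rewrite TS; apply: (weighted_block q0 q1 D1 X0 H); exact: le_trans (TT0 n).
Qed.

End WeightedIntegral.

Section GeometricBlocks.
Context {R : realType}.

(** The ratio tends to q^(k - eta), which is less than 1. *)
Lemma theta_geometric_decay (eta k q : R) (g : R -> R) : 0 < q -> q < 1 -> eta < k ->
  regularly_varying eta g ->
  exists rho T, [/\ 0 < rho, rho < 1 & forall t, T < t ->
    g (t / q) * (t / q) `^ (- k) <= rho * (g t * t `^ (- k))].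
Proof.
move=> q0 q1 ek [_ g0 hg].
have qi0 : 0 < q^-1 by rewrite invr_gt0.
have qi : 1 < q^-1 by rewrite invf_gt1.
have lt1 : q^-1 `^ eta < q^-1 `^ k.
  rewrite /powR gt_eqF// ltr_expR ltr_pM2r// ln_gt0//.
pose e := (q^-1 `^ k - q^-1 `^ eta) / 2.
have e0 : 0 < e by rewrite /e; lra.
have qe : 0 < q^-1 `^ eta by exact: powR_gt0.
have qk : 0 < q^-1 `^ k by exact: powR_gt0.
have /cvgrPdist_lt /(_ e e0) [T [_ HT]] := hg _ qi0.
exists ((q^-1 `^ eta + e) / q^-1 `^ k), (Num.max T 0); split.
- by rewrite divr_gt0// addr_gt0.
- by rewrite ltr_pdivrMr// mul1r /e; lra.
move=> t; rewrite gt_max => /andP[/HT /= h t0].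
have gt : 0 < g t by apply: g0; exact: ltW.
have {}h : g (t / q) <= (q^-1 `^ eta + e) * g t.
  by rewrite -ler_pdivrMr// [t / q]mulrC; move: h; rewrite ltr_norml; lra.
rewrite powRM ?(ltW t0) ?(ltW qi0)// [q^-1 `^ (- k)]powRN.
have tk : 0 < t `^ (- k) by exact: powR_gt0.
have -> : (q^-1 `^ eta + e) / q^-1 `^ k * (g t * t `^ (- k)) =
  (q^-1 `^ eta + e) * g t * (t `^ (- k) * (q^-1 `^ k)^-1) by ring.
by rewrite ler_pM2r// mulr_gt0// invr_gt0.
Qed.

Lemma geometric_block_div (q T0 t : R) : 0 < q -> q < 1 -> 0 < T0 -> T0 <= t ->
  exists n, T0 / q ^+ n <= t < T0 / q ^+ n.+1.
Proof.
move=> q0 q1 T00 Tt.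
have [||n /andP[n1 n2]] := @geometric_block R q^-1 (t / T0).
- by rewrite invf_gt1.
- by rewrite ler_pdivlMr// mul1r.
exists n; rewrite -!exprVn; apply/andP; split.
  by move: n1; rewrite ler_pdivlMr// mulrC.
by move: n2; rewrite ltr_pdivrMr// mulrC.
Qed.

End GeometricBlocks.

Theorem theorem10 (R : realType) (q a b zeta eta : R) (f x y gamma : R -> R)
    (hq0 : 0 < q) (hq1 : q < 1) (ha : a != 0) (hb : b < 0)
    (hab : `|a| < `|b|)
    (hf : {within `[0, +oo[, continuous f})
    (hx : pantograph_solution q a b f zeta x)
    (hy : perturbation_solution f y)
    (hgamma : regularly_varying eta gamma) :
  let k := kappa q a b in
  (y =O_+oo gamma ->
    [/\ (* (A) *)
        eta < k -> x =O_+oo (fun t : R => t `^ k),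
        (* (B) *)
        eta = k -> weighted_L1 k gamma ->
          x =O_+oo (fun t : R => t `^ k) /\
          ((0 < limsup_ratio y gamma < +oo)%E ->
            (0 < limsup_ratio x gamma)%E) &
        (* (C) *)
        eta = k -> ~ weighted_L1 k gamma ->
          ebigO_pinfty x
            (fun t => ((t `^ k)%:E * weighted_integral k gamma t)%E) /\
          ((0 < limsup_ratio y gamma)%E ->
            (0 < limsup_ratio x gamma)%E)]) /\
  ((x =O_+oo gamma -> y =O_+oo gamma) /\
   (x =o_+oo gamma -> y =o_+oo gamma)).
Proof.
move=> k.
have [mg g0 _] := hgamma.
have g0' (t : R) : 0 < t -> 0 < gamma t by move=> /ltW/g0.
have [C [X [M [C1 X0 pot]]]] := potter_of_rv hgamma.
have [E E0 HE] := perturbation_bound C1 X0 g0 pot hq0 hq1 hx hy.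
have k0 : k < 0 by exact: kappa_lt0.
have aqk : `|a| * q `^ k = - b by exact: powR_kappa.
have tk (t : R) : 0 < t -> 0 < t `^ k by exact: powR_gt0.
pose theta t := gamma t * t `^ (- k).
have th0 t : 0 < t -> 0 < theta t by move=> t0; rewrite mulr_gt0 ?powR_gt0 ?g0'.
have little : (forall e, 0 < e -> eventually_le x gamma e) ->
    forall e, 0 < e -> eventually_le y gamma e.
  move=> H e e0; have eE : 0 < e / E by rewrite divr_gt0.
  have := HE _ eE (H _ eE).
  by rewrite mulrCA divff ?mulr1// gt_eqF.
have limsup : (0 < limsup_ratio y gamma)%E -> (0 < limsup_ratio x gamma)%E.
  move=> yl; apply: contrapT => /(limsup_ratio_gt0P _ g0')/little.
  by move/(limsup_ratio_gt0P _ g0').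
split; last first.
  split.
    move=> /(eqO_pinftyP _ g0')[K K0 H]; apply/(eqO_pinftyP _ g0').
    by exists (E * K); [rewrite mulr_gt0|exact: HE].
  by move=> /(eqo_pinftyP _ g0')/little H; apply/(eqo_pinftyP _ g0').
move=> /(eqO_pinftyP _ g0')[K K0 yK].
have [T1 growth] := solution_growth C1 X0 g0 pot hq0 hq1 k0 hb aqk hx hy K0 yK.
have [D D1 HD] := theta_block C1 X0 g0 pot hq0 hq1 k0.
have sumbound T0 S : T1 < T0 -> 0 < T0 -> 0 <= S ->
    (forall n, \sum_(j < n) theta (T0 / q ^+ j) <= S) ->
    x =O_+oo (fun t : R => t `^ k).
  move=> TT0 T00 S0 HS; apply/(eqO_pinftyP _ tk).
  have [A A0 HA] := growth T0 TT0.
  exists (A * (1 + S)); first by rewrite mulr_gt0// ltr_pwDl.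
  exists T0; split; first exact: num_real.
  move=> t /= T0t; have t0 : 0 < t by exact: lt_trans T0t.
  have [n /andP[n1 n2]] := geometric_block_div hq0 hq1 T00 (ltW T0t).
  apply: le_trans (HA n t _) _; first by rewrite n1 ltW.
  by rewrite mulrAC ler_pM2r ?tk// ler_pM2l// lerD2l.
split.
- move=> ek; have [rho [T2 [r0 r1 H]]] := theta_geometric_decay hq0 hq1 ek hgamma.
  pose T0 := Num.max 1 (Num.max (T1 + 1) (T2 + 1)).
  have [T00 T10 T20] : [/\ 0 < T0, T1 < T0 & T2 < T0].
    by rewrite /T0 !lt_max ltr01 !ltrDl ltr01 !orbT.
  have TT0 n : T0 <= T0 / q ^+ n.
    by rewrite ler_pdivlMr ?exprn_gt0// ler_piMr ?(ltW T00)// exprn_ile1// ltW.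
  have geo n : theta (T0 / q ^+ n) <= theta T0 * rho ^+ n.
    elim: n => [|n IH]; first by rewrite !expr0 divr1 mulr1.
    have -> : T0 / q ^+ n.+1 = T0 / q ^+ n / q.
      by rewrite exprSr; field; rewrite (gt_eqF hq0) gt_eqF ?exprn_gt0.
    have := H _ (lt_le_trans T20 (TT0 n)); move=> /le_trans; apply.
    by rewrite exprS [leRHS]mulrCA ler_pM2l.
  apply: (sumbound T0 (theta T0 / (1 - rho))) => //.
    by rewrite divr_ge0 ?subr_ge0 ?(ltW r1)// ltW// th0.
  move=> n; apply: le_trans (_ : \sum_(j < n) theta T0 * rho ^+ j <= _).
    by apply: ler_sum => j _.
  have -> : \sum_(j < n) theta T0 * rho ^+ j = theta T0 * \sum_(j < n) rho ^+ j.
    by rewrite mulr_sumr.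
  by rewrite ler_pM2l ?th0//; exact: geometric_sum_le.
all: move=> _ L1.
all: pose T0 := Num.max 1 (Num.max (T1 + 1) X).
all: have [T01 T10 XT0] : [/\ 1 <= T0, T1 < T0 & X <= T0];
  [by rewrite /T0 !le_max !lt_max !lexx !ltrDl ltr01 !orbT|].
all: have T00 : 0 < T0 by exact: lt_le_trans T01.
all: have D0 : 0 < D by exact: lt_le_trans D1.
all: pose c := (1 - q) / D.
all: have c0 : 0 < c by rewrite divr_gt0// subr_gt0.
all: have sums := weighted_sum mg g0 hq0 hq1 D1 X0 HD XT0.
- split; last by move=> /andP[/limsup].
  have /integrableP [mw fin] := L1.
  pose I := (\int[@completed_lebesgue_measure R]_(t in `]0%R, +oo[) weighted k gamma t)%E.
  have Ifin : (I < +oo)%E.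
    apply: le_lt_trans fin; rewrite le_eqVlt; apply/orP; left; apply/eqP.
    apply: eq_integral => t; rewrite inE => t0; rewrite gee0_abs//.
    by apply: weighted_ge0 => //; move: t0; rewrite /= in_itv/= andbT.
  have I0 : (0 <= I)%E.
    apply: integral_ge0 => t /=; rewrite in_itv/= andbT; exact: weighted_ge0.
  apply: (sumbound T0 (fine I / c)) => //; first by rewrite divr_ge0 ?fine_ge0// ltW.
  move=> n; rewrite ler_pdivlMr// mulrC -lee_fin fineK ?ge0_fin_numE//.
  apply: le_trans (sums n) _; apply: ge0_subset_integral => //.
  + exact: measurable_itv_completed.
  + exact: measurable_itv_completed.
  + by move=> t /=; rewrite in_itv/= andbT; exact: weighted_ge0.
  + by move=> t /=; rewrite !in_itv/= andbT => /andP[t1 _]; exact: lt_trans t1.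
- split; last exact: limsup.
  have [A A0 HA] := growth T0 T10.
  have t00 := th0 _ T00.
  (* for t >= T_1 the sum contains theta T0, so 1 + S <= B S *)
  pose B := (theta T0)^-1 + 1.
  have B0 : 0 < B by rewrite addr_gt0// invr_gt0.
  exists (A * B / c); first by rewrite !mulr_gt0// invr_gt0.
  exists (T0 / q); split; first exact: num_real.
  have qT : T0 < T0 / q by rewrite ltr_pdivlMr// gtr_pMr.
  move=> t /= T0t; have t0 : 0 < t by lra.
  have [n /andP[n1 n2]] := geometric_block_div hq0 hq1 T00 (ltW (lt_trans qT T0t)).
  case: n n1 n2 => [|n] n1 n2; first by have := lt_trans T0t n2; rewrite expr1 ltxx.
  pose S := \sum_(j < n.+1) theta (T0 / q ^+ j).
  have S1 : theta T0 <= S.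
    rewrite /S big_ord_recl/= expr0 divr1 lerDl sumr_ge0// => j _.
    by rewrite ltW// th0// divr_gt0// exprn_gt0.
  have HI : ((c * S)%:E <= weighted_integral k gamma t)%E.
    apply: le_trans (sums n.+1) _; apply: ge0_subset_integral => //.
    + exact: measurable_itv_completed.
    + exact: measurable_itv_completed.
    + apply: measurable_weighted => //; first exact: measurable_itv_completed.
      by move=> s /=; rewrite !in_itv/= andbT => /andP[s1 _]; lra.
    + by move=> s /=; rewrite in_itv/= => /andP[s1 _]; apply: weighted_ge0 => //; lra.
    + by move=> s /=; rewrite !in_itv/= => /andP[s1 s2]; apply/andP; split; lra.
  have tk0 := tk _ t0.
  have h : `|x t| <= A * t `^ k * (1 + S) by apply: HA; rewrite n1 ltW.
  have ABc : 0 < A * B / c by rewrite !mulr_gt0// invr_gt0.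
  apply: le_trans (_ : ((A * B / c)%:E * ((t `^ k)%:E * (c * S)%:E) <= _)%E); last first.
    by rewrite lee_pmul2l ?lte_fin// lee_pmul2l ?lte_fin.
  rewrite -!EFinM lee_fin; apply: le_trans h _.
  have -> : A * B / c * (t `^ k * (c * S)) = A * t `^ k * (B * S).
    by field; rewrite gt_eqF.
  rewrite ler_pM2l ?mulr_gt0// /B mulrDl mul1r lerD2r.
  by rewrite mulrC ler_pdivlMr// mul1r.
Qed.
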